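(* For all $p\in(0,1)$ and all $\alpha,\beta\in[0,1]$, the $p$-rotor walk $(X_n)_{n\ge0}$ on $\mathbb{Z}$ with $(\alpha,\beta)$-random initial configuration is recurrent, that is, $\mathbb{P}[X_n=0\text{ for infinitely many } n]=1$.
   Context: The $p$-rotor walk. For $p\in[0,1]$ the $p$-rotor walk is the first component of the Markov chain $(X_n,\rho_n)_{n\ge0}$ on $\mathbb{Z}\times\{-1,+1\}^{\mathbb{Z}}$ with $X_0=0$, a (random) initial rotor configuration $\rho_0$, and dynamics: let $B_0,B_1,\ldots$ be i.i.d., independent of $\rho_0$, with $P(B_n=1)=p=1-P(B_n=-1)$; set $\rho_{n+1}(x)=\rho_n(x)$ for $x\ne X_n$, $\rho_{n+1}(X_n)=B_n\rho_n(X_n)$, and $X_{n+1}=X_n+\rho_{n+1}(X_n)$. The $(\alpha,\beta)$-random initial configuration ($\alpha,\beta\in[0,1]$): the variables $(\rho_0(x))_{x\in\mathbb{Z}}$ are independent; for $x<0$, $\rho_0(x)=-1$ with probability $\beta$ and $+1$ with probability $1-\beta$; for $x=0$, $\rho_0(0)=\pm1$ with probability $1/2$ each; for $x>0$, $\rho_0(x)=+1$ with probability $\alpha$ and $-1$ with probability $1-\alpha$. *)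

(* Defs.v *)
From HB Require Import structures.
From mathcomp Require Import all_boot all_order all_algebra.
From mathcomp Require Import all_classical all_reals all_analysis.

Set Implicit Arguments.
Unset Strict Implicit.
Unset Printing Implicit Defensive.

Import Order.TTheory GRing.Theory Num.Theory.

Local Open Scope classical_set_scope.
Local Open Scope ring_scope.

HB.instance Definition _ := isPointed.Build int 0.

(* As for [nat] and [bool] in the library, [int] carries the discrete
   sigma-algebra. *)
HB.instance Definition _ := @isMeasurable.Build default_measure_display
  int discrete_measurable (@discrete_measurable0 int)
  (@discrete_measurableC int) (@discrete_measurableU int).

Section Independence.
Context (d : measure_display) (T : measurableType d) (R : realType).
Context (P : probability T R).
Context (d1 : measure_display) (S1 : measurableType d1).

Definition mutually_independent (I : eqType) (Y : I -> {RV P >-> S1}) : Prop :=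
  forall (s : seq I) (E : I -> set S1), uniq s -> (forall i, measurable (E i)) ->
    P (\bigcap_(i in [set` s]) (Y i @^-1` E i)) =
    (\prod_(i <- s) P (Y i @^-1` E i))%E.

Definition process_sigma_algebra (I : Type) (Y : I -> {RV P >-> S1}) :
    set (set T) :=
  <<s [set A | exists i (E : set S1), measurable E /\ A = Y i @^-1` E] >>.

End Independence.

Definition independent_processes (d : measure_display) (T : measurableType d)
    (R : realType) (P : probability T R)
    (d1 d2 : measure_display) (S1 : measurableType d1) (S2 : measurableType d2)
    (I J : Type) (Y : I -> {RV P >-> S1}) (Z : J -> {RV P >-> S2}) : Prop :=
  forall A B : set T,
    process_sigma_algebra Y A -> process_sigma_algebra Z B ->
    P (A `&` B) = (P A * P B)%E.

Definition is_sign (a : int) : Prop := a = 1 \/ a = -1.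

(* The position of the walker, and the rotors. *)
Definition state : Type := (int * (int -> int))%type.

(* The rotor at the current position is updated first; the walker then follows
   the updated rotor. *)
Definition rotor_step (b : int) (s : state) : state :=
  let x := s.1 in
  let rho := s.2 in
  let rho' := fun y => if y == x then b * rho x else rho y in
  (x + rho' x, rho').

Fixpoint rotor_chain (b : nat -> int) (rho0 : int -> int) (n : nat) : state :=
  if n is m.+1 then rotor_step (b m) (rotor_chain b rho0 m) else (0, rho0).

Definition rotor_walk (b : nat -> int) (rho0 : int -> int) (n : nat) : int :=
  (rotor_chain b rho0 n).1.

Section RandomInputs.
Context (d : measure_display) (T : measurableType d) (R : realType).
Context (P : probability T R).

Record iid_signs (p : R) (B : nat -> {RV P >-> int}) : Prop := {
  iid_signs_sign : forall n w, is_sign (B n w);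
  iid_signs_pos : forall n, P [set w | B n w = 1] = p%:E;
  iid_signs_neg : forall n, P [set w | B n w = -1] = (1 - p)%:E;
  iid_signs_indep : mutually_independent B }.

Record random_initial_configuration (alpha beta : R)
    (rho0 : int -> {RV P >-> int}) : Prop := {
  ric_sign : forall x w, is_sign (rho0 x w);
  ric_lt0_neg : forall x, x < 0 -> P [set w | rho0 x w = -1] = beta%:E;
  ric_lt0_pos : forall x, x < 0 -> P [set w | rho0 x w = 1] = (1 - beta)%:E;
  ric_0_neg : P [set w | rho0 0 w = -1] = (2^-1)%:E;
  ric_0_pos : P [set w | rho0 0 w = 1] = (2^-1)%:E;
  ric_gt0_pos : forall x, 0 < x -> P [set w | rho0 x w = 1] = alpha%:E;
  ric_gt0_neg : forall x, 0 < x -> P [set w | rho0 x w = -1] = (1 - alpha)%:E;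
  ric_indep : mutually_independent rho0 }.

End RandomInputs.

(* Main.v *)
Require Import Defs.
From HB Require Import structures.
From mathcomp Require Import all_boot all_order all_algebra.
From mathcomp Require Import all_classical all_reals all_analysis.
From mathcomp Require Import measurable_realfun.
From mathcomp Require Import zify ring lra.

(** Recurrence holds for every initial configuration of signs, with bounds that
    do not depend on the configuration; randomness of [rho0] enters only
    through an average at the very end.

    The rotor at a vertex left behind shows the direction of the last exit.
    Hence, when the walk stands at a vertex [N > 0], all rotors at [0 < y < N]
    point right ([last_exits]), whatever the configuration further on. Call such
    a position fresh, and follow the walk until it reaches [0] or [N.+1]. In the
    strip between, the rotors left of the walker point right and those right of
    it point left, so the future depends only on the position and on the rotor
    there. With [q = min p (1 - p)] and [k = p / (1 - p)], the walk plus a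
    multiple of the sum of the rotors is a martingale, and this gives the
    probability of leaving the strip on the right: from [N], it is at most
    [1 - min 1 k / (1 + k N) <= 1 - q / N.+1]. The walk cannot stay in the strip
    for ever, since from each state it runs straight out with positive
    probability. So each new record [N] costs a factor [1 - q / N.+1], and
    a walk that escapes to infinity would pay all of them: their product is [0]
    because the harmonic series diverges ([fresh_avoidance_small]). Negative
    positions reduce to positive ones by reflection.

    All this is said about [avoidance p n s], the probability that the walk
    started in the state [s] avoids [0] up to time [n], given by its one-step
    recursion, so that only finite sums occur. The result is that
    [avoidance p n s] is small for [n] large, uniformly in the states [s] that
    the walk can occupy at a given time [k] ([last_exits_avoidance_small]).

    To return to the probability space, the event of avoiding [0] between the
    times [k] and [k + n] is covered by finitely many events, one for each word
    of [k + n] signs taken by [B]; independence turns each into a product of the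
    weight of the word and the probability of an event about [rho0]. The sum is
    the expectation of a function of [rho0] which is small pointwise
    ([late_avoidance_event_le]). Thus the walk almost surely does not avoid [0]
    from the time [k] on, and a union over [k] ends the proof. *)

Set Implicit Arguments.
Unset Strict Implicit.
Unset Printing Implicit Defensive.

Import Order.TTheory GRing.Theory Num.Theory.

Local Open Scope classical_set_scope.
Local Open Scope ring_scope.

(** * The probability of avoiding the origin *)

Definition set_rotor (rho : int -> int) (x c : int) : int -> int :=
  fun y => if y == x then c else rho y.

Definition exit_to (c : int) (s : state) : state :=
  (s.1 + c, set_rotor s.2 s.1 c).

Lemma rotor_stepE b s : rotor_step b s = exit_to (b * s.2 s.1) s.
Proof. by rewrite /rotor_step /exit_to /= eqxx. Qed.

Definition signs (rho : int -> int) : Prop := forall y, is_sign (rho y).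

Lemma set_rotor_signs rho x c :
  is_sign c -> signs rho -> signs (set_rotor rho x c).
Proof. by move=> hc hs y; rewrite /set_rotor; case: ifP. Qed.

Lemma is_signM a b : is_sign a -> is_sign b -> is_sign (a * b).
Proof. by rewrite /is_sign; case=> ->; case=> ->; [left|right|right|left]. Qed.

(** The probability that the walk started in [s], driven by independent signs
    equal to [1] with probability [p], is nonzero at the times [0, ..., n]. *)
Fixpoint avoidance (R : realType) (p : R) (n : nat) (s : state) : R :=
  if s.1 == 0 then 0 else
  if n is m.+1 then
    p * avoidance p m (rotor_step 1 s)
    + (1 - p) * avoidance p m (rotor_step (-1) s)
  else 1.

Lemma avoidance0 (R : realType) (p : R) n s : s.1 = 0 -> avoidance p n s = 0.
Proof. by case: n => [|n] /= ->; rewrite eqxx. Qed.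

Lemma avoidance_itv (R : realType) (p : R) n s : 0 < p < 1 ->
  0 <= avoidance p n s <= 1.
Proof.
move=> hp; elim: n s => [|n IH] s /=; case: ifP => _; try lra.
by move: (IH (rotor_step 1 s)) (IH (rotor_step (-1) s)); nra.
Qed.

Lemma avoidanceS_le (R : realType) (p : R) n s : 0 < p < 1 ->
  avoidance p n.+1 s <= avoidance p n s.
Proof.
move=> hp; elim: n s => [|n IH] s.
  rewrite /=; case: ifP => // _.
  have := avoidance_itv 0 (rotor_step 1 s) hp.
  have := avoidance_itv 0 (rotor_step (-1) s) hp.
  rewrite /=; nra.
have h1 := IH (rotor_step 1 s); have h2 := IH (rotor_step (-1) s).
rewrite [leLHS]/= -/(avoidance p n.+1 _) [leRHS]/=.
case: ifP => // _.
by apply: lerD; apply: ler_wpM2l => //; lra.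
Qed.

Lemma avoidance_le (R : realType) (p : R) m n s : 0 < p < 1 -> (m <= n)%N ->
  avoidance p n s <= avoidance p m s.
Proof.
move=> hp /subnK <-; elim: (n - m)%N => // k IH.
by rewrite addSn; apply: le_trans (avoidanceS_le _ _ hp) IH.
Qed.

(** Seen from a rotor [sigma], the probability that the walker leaves to the
    right; also the probability that the sign driving a step equals [sigma]. *)
Definition turn_prob (R : realType) (p : R) (sigma : int) : R :=
  if sigma == 1 then p else 1 - p.

(** The one-step recursion, by direction of exit rather than by sign. *)
Lemma avoidanceS (R : realType) (p : R) n s : s.1 != 0 -> is_sign (s.2 s.1) ->
  avoidance p n.+1 s =
    turn_prob p (s.2 s.1) * avoidance p n (exit_to 1 s) +
    (1 - turn_prob p (s.2 s.1)) * avoidance p n (exit_to (-1) s).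
Proof.
move=> /negbTE h0 hs /=; rewrite h0 !rotor_stepE.
case: hs => ->; rewrite /turn_prob /=.
  by rewrite !mulr1.
by rewrite mulrNN !mulr1 mul1r; ring.
Qed.

(** * Leaving a strip *)

(** The walker is at [n], below the record [N]. *)
Definition strip (N n : nat) (rho : int -> int) : Prop :=
  [/\ signs rho, forall y, 0 < y < n%:Z -> rho y = 1 &
      forall y, n%:Z < y <= N%:Z -> rho y = -1].

(** The walker is at [N > 0], and nothing is known of the rotors at [N] and
    beyond, as when it arrives at [N] for the first time. *)
Definition fresh (N : nat) (rho : int -> int) : Prop :=
  signs rho /\ forall y, 0 < y < N%:Z -> rho y = 1.

Lemma strip_right N n rho : (n < N)%N -> strip N n rho ->
  strip N n.+1 (set_rotor rho n%:Z 1) /\ set_rotor rho n%:Z 1 n.+1%:Z = -1.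
Proof.
move=> nN [sr rl rr]; split; last by rewrite /set_rotor ifF; [apply: rr|]; lia.
split; first by apply: set_rotor_signs => //; left.
- by move=> y hy; rewrite /set_rotor; case: eqVneq => // yn; apply: rl; lia.
- move=> y hy; rewrite /set_rotor; case: eqVneq => [yn|_]; first lia.
  by apply: rr; lia.
Qed.

Lemma strip_left N n rho : (1 < n)%N -> strip N n rho ->
  strip N n.-1 (set_rotor rho n%:Z (-1)) /\
  set_rotor rho n%:Z (-1) n.-1%:Z = 1.
Proof.
move=> n1 [sr rl rr]; split; last by rewrite /set_rotor ifF; [apply: rl|]; lia.
split; first by apply: set_rotor_signs => //; right.
- move=> y hy; rewrite /set_rotor; case: eqVneq => [yn|_]; first lia.
  by apply: rl; lia.
- by move=> y hy; rewrite /set_rotor; case: eqVneq => // yn; apply: rr; lia.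
Qed.

Lemma strip_leave N rho : strip N N rho -> fresh N.+1 (set_rotor rho N%:Z 1).
Proof.
move=> [sr rl _]; split; first by apply: set_rotor_signs => //; left.
by move=> y hy; rewrite /set_rotor; case: eqVneq => // yN; apply: rl; lia.
Qed.

(** Both terms on the right are potentials for the walk in the strip.
    The first one is [h] times the probability of leaving it on the right.
    That probability comes from the martingale [x + c S], where [x] is the
    position, [S] the sum of the rotors in the strip and
    [c = (2 p - 1) / (2 (1 - p))], so that [k = 1 + 2 c]: it is an affine
    function of the martingale that vanishes upon arrival at [0] and is [1] upon
    arrival at [N.+1].
    The second one bounds the probability of still being in the strip after [j]
    steps: [K - L ^+ x] lies between [1] and [K], and since the walk goes right
    with probability at least [q = min p (1 - p)] and [q L = 2], one step
    decreases its mean by at least [L ^+ x >= 1], hence multiplies it by at most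
    [1 - K^-1]. *)
Lemma strip_bound (R : realType) (p h : R) (N m0 : nat) : 0 < p < 1 -> 0 <= h ->
  (forall rho, fresh N.+1 rho -> avoidance p m0 (N.+1%:Z, rho) <= h) ->
  let k := p / (1 - p) in
  let L : R := 2 / Num.min p (1 - p) in
  let K : R := L ^+ N.+1 + 1 in
  forall j n rho, (0 < n <= N)%N -> strip N n rho ->
    avoidance p (m0 + j)%N (n%:Z, rho) <=
      (k * n%:R + (if rho n%:Z == 1 then 0 else 1 - k)) / (1 + k * N%:R) * h
      + (1 - K^-1) ^+ j * (K - L ^+ n).
Proof.
move=> hp h0 hN k L K.
have q0 : 0 < Num.min p (1 - p) by rewrite lt_min; lra.
have qp : Num.min p (1 - p) <= p by rewrite ge_min lexx.
have qp' : Num.min p (1 - p) <= 1 - p by rewrite ge_min lexx orbT.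
have kE : k * (1 - p) = p by rewrite /k mulfVK //; lra.
have k0 : 0 < k by rewrite /k divr_gt0 //; lra.
have LE : Num.min p (1 - p) * L = 2 by rewrite /L mulrC mulfVK //; lra.
have L1 : 1 <= L by rewrite /L ler_pdivlMr // mul1r; lra.
have D0 : 0 < 1 + k * N%:R by rewrite ltr_pwDl // mulr_ge0 // ltW.
set q := Num.min p _ in q0 qp qp' LE.
have Lmono i j : (i <= j)%N -> L ^+ i <= L ^+ j by exact: ler_weXn2l.
have LN0 : 1 <= L ^+ N.+1 by rewrite exprn_ege1.
have K1 : 1 <= K by rewrite /K; lra.
have th0 : 0 <= 1 - K^-1 by rewrite subr_ge0 invf_le1 //; lra.
elim=> [|j IH] n rho /andP[n0 nN] hs.
  apply: (@le_trans _ _ 1); first by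
     case/andP: (avoidance_itv (m0 + 0)%N (n%:Z, rho) hp).
  rewrite expr0 mul1r.
  have h1 : 1 <= K - L ^+ n by rewrite /K; have := Lmono n N.+1 (leqW nN); lra.
  have h2 : 0 <= k * n%:R + (if rho n == 1 then 0 else 1 - k).
    have n1 : 1 <= n%:R :> R by rewrite ler1n.
    by case: ifP => _; nra.
  rewrite -[leLHS]add0r; apply: lerD => //; apply: mulr_ge0 => //.
  exact: divr_ge0 (ltW D0).
have sn : is_sign (rho n%:Z) by case: hs => sr _ _; exact: sr.
rewrite addnS avoidanceS //=; last by rewrite eqz_nat -lt0n.
set r := turn_prob _ _.
have rq : q <= r by rewrite /r /turn_prob; case: ifP.
have r1 : q <= 1 - r.
  by rewrite /r /turn_prob; case: ifP => _ //; rewrite opprB addrC subrK.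
set D := 1 + k * N%:R in D0 *.
set e := (1 - K^-1) ^+ j.
have e0 : 0 <= e by exact: exprn_ge0.
have right_le : avoidance p (m0 + j)%N (exit_to 1 (n%:Z, rho)) <=
    (k * n%:R + 1) / D * h + e * (K - L ^+ n.+1).
  rewrite /exit_to /= addrC -intS.
  move: nN; rewrite leq_eqVlt => /orP[/eqP nN|nN].
    (* the walk reaches [N.+1], where the first potential equals [h] *)
    apply: (le_trans (avoidance_le _ hp (leq_addr _ _))).
    move: hs; rewrite nN => hs; apply: (le_trans (hN _ (strip_leave hs))).
    rewrite (addrC _ 1) divff ?gt_eqF // mul1r lerDl mulr_ge0 //.
    by rewrite /K; lra.
  have [hs' rn] := strip_right nN hs.
  apply: (le_trans (IH n.+1 _ nN hs')); rewrite rn /=.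
  by rewrite -[n.+1%:R]natr1 mulrDr mulr1 -addrA (addrC k) subrK.
have left_le : avoidance p (m0 + j)%N (exit_to (-1) (n%:Z, rho)) <=
    (k * n.-1%:R) / D * h + e * (K - L ^+ n.-1).
  rewrite /exit_to /= -predn_int //.
  (* for [n = 1] the walk reaches the origin, where the first potential is 0 *)
  have [n1|n1] := ltnP 1 n; last first.
    have {n1}-> : n = 1%N by apply/eqP; rewrite eqn_leq n1.
    rewrite avoidance0 //= mulr0 !mul0r add0r mulr_ge0 //.
    by rewrite expr0 /K; lra.
  have [hs' rn] := strip_left n1 hs.
  have nN' : (0 < n.-1 <= N)%N.
    by rewrite -ltnS prednK // n1 (leq_trans (leq_pred n)).
  by apply: (le_trans (IH n.-1 _ nN' hs')); rewrite rn eqxx addr0.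
have r01 : 0 <= r /\ 0 <= 1 - r by lra.
apply: (le_trans (lerD (ler_wpM2l r01.1 right_le) (ler_wpM2l r01.2 left_le))).
have nE : n%:R = 1 + n.-1%:R :> R by rewrite -{1}(prednK n0) -nat1r.
(* harmonicity of the first potential *)
have harm : r * (k * n%:R + 1) + (1 - r) * (k * n.-1%:R) =
    k * n%:R + (if rho n%:Z == 1 then 0 else 1 - k).
  rewrite nE /r /turn_prob; case: ifP => _; lra.
have drift : r * (K - L ^+ n.+1) + (1 - r) * (K - L ^+ n.-1) <=
    (1 - K^-1) * (K - L ^+ n).
  have Kv : K^-1 * K = 1 by rewrite mulVf //; lra.
  have Kv0 : 0 <= K^-1 by rewrite invr_ge0; lra.
  have Ln : 1 <= L ^+ n by rewrite exprn_ege1.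
  have Ln1 : 0 <= L ^+ n.-1 by rewrite exprn_ge0 //; lra.
  have rL : 2 <= r * L by rewrite -LE ler_wpM2r //; lra.
  have : 2 * L ^+ n <= r * L ^+ n.+1.
    rewrite exprS mulrA ler_wpM2r //; lra.
  have := mulr_ge0 r01.2 Ln1.
  have := mulr_ge0 Kv0 (le_trans ler01 Ln).
  move: (L ^+ n.+1) (L ^+ n.-1) (L ^+ n) Ln Kv Kv0 => a b c; move: (K^-1) => i.
  by clear; move=> *; lra.
rewrite [X in X <= _](_ : _ =
  (r * (k * n%:R + 1) + (1 - r) * (k * n.-1%:R)) / D * h +
  e * (r * (K - L ^+ n.+1) + (1 - r) * (K - L ^+ n.-1))); last by ring.
by rewrite harm lerD2l (exprSr (1 - K^-1)) -mulrA ler_wpM2l.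
Qed.

Lemma strip_fresh N rho : fresh N rho -> strip N N rho.
Proof. by case=> sr rl; split=> // y; lia. Qed.

(** A walk that avoids [0] must reach [N.+1], unless it stays in the strip for
    a long time; the probability of the former is at most [1 - q / N.+1]. *)
Lemma fresh_contraction (R : realType) (p h e : R) (N m0 : nat) :
  0 < p < 1 -> 0 <= h -> 0 < e -> (0 < N)%N ->
  (forall rho, fresh N.+1 rho -> avoidance p m0 (N.+1%:Z, rho) <= h) ->
  exists m, forall rho, fresh N rho ->
    avoidance p m (N%:Z, rho) <= (1 - Num.min p (1 - p) / N.+1%:R) * h + e.
Proof.
move=> hp h0 e0 N0 hN.
have := strip_bound hp h0 hN; cbv zeta.
set q := Num.min p _; set k := p / (1 - p); set L : R := 2 / q.
set K : R := _ + 1 => bound.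
have k0 : 0 < k by rewrite divr_gt0 //; lra.
have kE : k * (1 - p) = p by rewrite /k mulfVK //; lra.
clearbody k; have q0 : 0 < q by rewrite lt_min; lra.
have qp : q <= p by rewrite ge_min lexx.
have qp' : q <= 1 - p by rewrite ge_min lexx orbT.
have L0 : 0 < L by rewrite divr_gt0.
have K0 : 0 < K by rewrite addr_gt0 ?exprn_gt0.
have K1 : 1 < K by rewrite ltrDr exprn_gt0.
have th : `|1 - K^-1| < 1.
  have : 0 < K^-1 by rewrite invr_gt0.
  have : K^-1 < 1 by rewrite invf_lt1.
  by move: (K^-1) => i i1 i0; rewrite ger0_norm; lra.
have := cvg_expr th; move=> /cvgrPdist_lt /(_ (e / K)).
rewrite divr_gt0 // => /(_ isT) [j _ /(_ j (leqnn j))] /=.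
rewrite sub0r normrN => /ltW hj.
exists (m0 + j)%N => rho hf.
apply: (le_trans (bound j N rho _ (strip_fresh hf))); first by rewrite N0 leqnn.
have D0 : 0 < 1 + k * N%:R by rewrite ltr_pwDl // mulr_ge0 // ltW.
apply: lerD.
  rewrite ler_wpM2r // ler_pdivrMr //.
  have N1 : 0 < N.+1%:R :> R by [].
  have NE : N.+1%:R = N%:R + 1 :> R by rewrite -natr1.
  (* because [(1 + k N) (1 - p) <= N + 1] *)
  have a1 : q / N.+1%:R * (1 + k * N%:R) <= q / (1 - p).
    rewrite -mulrA ler_wpM2l ?(ltW q0) // mulrC ler_pdivrMr //.
    rewrite [leRHS]mulrC ler_pdivlMr ?NE; last lra.
    have : 0 <= N%:R :> R by [].
    by move: (N%:R : R) kE hp => x; clear; nra.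
  have a2 : q / (1 - p) <= 1 by rewrite ler_pdivrMr ?mul1r //; lra.
  have a3 : q / (1 - p) <= k by rewrite ler_pdivrMr ?kE //; lra.
  move: a1 a2 a3; rewrite mulrBl mul1r.
  move: (k * _) (q / (1 - p)) (q / N.+1%:R * _) => a b c.
  by case: ifP => _; lra.
apply: (@le_trans _ _ ((e / K) * K)); last by rewrite mulfVK // gt_eqF.
apply: (le_trans (ler_norm _)); rewrite normrM.
apply: ler_pM => //; rewrite ger0_norm.
  by rewrite /K lerBlDr; have := exprn_ge0 N (ltW L0); lra.
rewrite subr_ge0 /K (le_trans (ler_weXn2l _ (leqnSn N))) ?lerDl //.
by rewrite /L ler_pdivlMr // mul1r; lra.
Qed.

(** * Accumulating the records *)

(** By induction, as [(1 - x) (1 + S + x) <= 1 + S]. It bounds a product of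
    factors [1 - x i] by the inverse of a sum, so that the product is small when
    the sum diverges. *)
Lemma prod_onem_le (R : realType) (x : nat -> R) (m n : nat) :
  (forall i, 0 <= x i <= 1) ->
  (\prod_(m <= i < n) (1 - x i)) * (1 + \sum_(m <= i < n) x i) <= 1.
Proof.
move=> x01; elim: n => [|n IH]; first by rewrite !big_geq // mul1r addr0.
have [mn|mn] := leqP m n; last by rewrite !big_geq // mul1r addr0.
rewrite !big_nat_recr //=.
have S0 : 0 <= \sum_(m <= i < n) x i.
  by apply: sumr_ge0 => i _; case/andP: (x01 i).
have P0 : 0 <= \prod_(m <= i < n) (1 - x i).
  by apply: prodr_ge0 => i _; rewrite subr_ge0; case/andP: (x01 i).
apply: le_trans IH; rewrite -mulrA ler_wpM2l //.
by move: (\sum_(m <= i < n) _) (x n) (x01 n) S0 => S y; clear; nra.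
Qed.

Lemma harmonic_product_small (R : realType) (q e : R) (m : nat) :
  0 < q <= 1 -> 0 < e ->
  exists n, (m <= n)%N /\ \prod_(m <= i < n) (1 - q / i.+1%:R) <= e.
Proof.
move=> q01 e0.
have x01 i : 0 <= q / i.+1%:R <= 1.
  have [q0 q1] := andP q01.
  rewrite divr_ge0 ?(ltW q0) //= ler_pdivrMr // mul1r (le_trans q1) //.
  by rewrite ler1n.
have nd : nondecreasing_seq (series (@harmonic R)).
  apply/nondecreasing_seqP => n; rewrite /series /= big_nat_recr //= lerDl.
  by rewrite invr_ge0.
have /cvgryPge/(_ (series harmonic m + (q * e)^-1)) :=
  nondecreasing_dvgn_lt nd (@dvg_harmonic R).
move=> [n0 _ /(_ (maxn n0 m) (leq_maxl _ _))] /=.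
set n := maxn n0 m; have mn : (m <= n)%N by exact: leq_maxr.
rewrite -lerBrDl sub_series_geq // => hn.
exists n; split=> //.
have := prod_onem_le m n x01; rewrite -mulr_sumr.
set S := \sum_(_ <= _ < _) _; set Pi := \prod_(_ <= _ < _) _ => hP.
have P0 : 0 <= Pi.
  by apply: prodr_ge0 => i _; rewrite subr_ge0; case/andP: (x01 i).
have qS : e^-1 <= q * S.
  rewrite -ler_pdivrMl; last by case/andP: q01.
  by rewrite -invfM.
have ee : e^-1 * e = 1 by rewrite mulVf // gt_eqF.
have : Pi * e^-1 <= 1.
  apply: le_trans hP; rewrite ler_wpM2l // (le_trans qS) // lerDr.
  exact: ler01.
by rewrite ler_pdivrMr // mul1r.
Qed.

(** The bound [1] at the record [d + N] is improved by a factor at each record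
    from there down to [N]. *)
Lemma fresh_avoidance_prod (R : realType) (p e : R) (d N : nat) :
  0 < p < 1 -> (0 < N)%N -> 0 < e ->
  exists m, forall rho, fresh N rho -> avoidance p m (N%:Z, rho) <=
    \prod_(N <= i < (d + N)%N) (1 - Num.min p (1 - p) / i.+1%:R) + e.
Proof.
move=> hp; elim: d N e => [|d IH] N e N0 e0.
  exists 0%N => rho _; rewrite big_geq //.
  by have := avoidance_itv 0 (N%:Z, rho) hp; lra.
have e20 : 0 < e / 2 by lra.
have [m hm] := IH N.+1 (e / 2) isT e20.
have x01 i : 0 <= 1 - Num.min p (1 - p) / i.+1%:R <= 1.
  have q0 : 0 < Num.min p (1 - p) by rewrite lt_min; lra.
  have q1 : Num.min p (1 - p) <= 1 by rewrite ge_min; apply/orP; left; lra.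
  have : 1 <= i.+1%:R :> R by rewrite ler1n.
  have : 0 <= Num.min p (1 - p) / i.+1%:R by rewrite divr_ge0 // ltW.
  have : Num.min p (1 - p) / i.+1%:R <= 1.
    by rewrite ler_pdivrMr // mul1r; apply: (le_trans q1); rewrite ler1n.
  by move: (_ / _) => x x1 x0 _; rewrite subr_ge0 x1 lerBlDr lerDl.
have P0 : 0 <=
    \prod_(N.+1 <= i < (d + N.+1)%N) (1 - Num.min p (1 - p) / i.+1%:R).
  by apply: prodr_ge0 => i _; case/andP: (x01 i).
have h0 := addr_ge0 P0 (ltW e20).
have [m' hm'] := fresh_contraction hp h0 e20 N0 hm.
exists m' => rho /hm' /le_trans; apply.
have lt_N : (N < d.+1 + N)%N by rewrite addSn ltnS leq_addl.
rewrite (big_ltn lt_N) addSnnS.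
move: (x01 N) P0.
move: (1 - _) (\prod_(_ <= _ < _) _) => y Q; move: e20; clear; nra.
Qed.

Lemma fresh_avoidance_small (R : realType) (p e : R) (N : nat) :
  0 < p < 1 -> (0 < N)%N -> 0 < e ->
  exists m, forall rho, fresh N rho -> avoidance p m (N%:Z, rho) <= e.
Proof.
move=> hp N0 e0.
have e20 : 0 < e / 2 by lra.
have q01 : 0 < Num.min p (1 - p) <= 1.
  by rewrite lt_min ge_min; apply/andP; split; [lra|apply/orP; left; lra].
have [n [Nn hn]] := harmonic_product_small N q01 e20.
have [m hm] := fresh_avoidance_prod (n - N) hp N0 e20.
exists m => rho /hm; rewrite subnK //; lra.
Qed.

(** * States reached by the walk *)

Definition reflect_state (s : state) : state := (- s.1, fun y => - s.2 (- y)).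

Lemma rotor_step_reflect b s :
  rotor_step b (reflect_state s) = reflect_state (rotor_step b s).
Proof.
rewrite !rotor_stepE /exit_to /reflect_state /= opprK mulrN -opprD.
congr pair; apply/funext => y; rewrite /set_rotor eqr_oppLR.
by case: ifP.
Qed.

Lemma avoidance_reflect (R : realType) (p : R) n s :
  avoidance p n (reflect_state s) = avoidance p n s.
Proof.
elim: n s => [|n IH] s /=; rewrite oppr_eq0 //.
by rewrite !rotor_step_reflect !IH.
Qed.

(** Between the origin and the walker, each rotor shows the last exit, which was
    towards the walker. *)
Definition last_exits (s : state) : Prop :=
  [/\ signs s.2, forall y, 0 <= y < s.1 -> s.2 y = 1 &
      forall y, s.1 < y <= 0 -> s.2 y = -1].

Lemma last_exits_step b s :
  is_sign b -> last_exits s -> last_exits (rotor_step b s).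
Proof.
case: s => x rho sb [/= sr hr hl]; rewrite rotor_stepE /exit_to /=.
have := is_signM sb (sr x); move: (b * rho x) => c sc.
split=> [|y|y] /=; first exact: set_rotor_signs.
  rewrite /set_rotor; case: eqVneq => [->|yx] hy; first by case: sc hy => ->; lia.
  by apply: hr; case: sc hy => ->; lia.
rewrite /set_rotor; case: eqVneq => [->|yx] hy; first by case: sc hy => ->; lia.
by apply: hl; case: sc hy => ->; lia.
Qed.

Lemma last_exits_avoidance_small (R : realType) (p e : R) (k : nat) :
  0 < p < 1 -> 0 < e ->
  exists m, forall s, last_exits s -> (`|s.1| <= k)%N -> avoidance p m s <= e.
Proof.
move=> hp e0; elim: k => [|k [m IH]].
  exists 0%N => -[x rho] _ /= x0; rewrite ifT ?(ltW e0) //; lia.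
have [m' hm'] := fresh_avoidance_small hp (ltn0Sn k) e0.
exists (maxn m m') => -[x rho] [/= sr hr hl] xk.
have [xk'|xk'] := leqP `|x| k.
  by apply: le_trans (avoidance_le _ hp (leq_maxl _ _)) (IH (x, rho) _ xk').
apply: le_trans (avoidance_le _ hp (leq_maxr m m')) _.
have [x0|x0] := leP 0 x.
  have -> : x = k.+1%:Z by lia.
  apply: hm'; split=> // y hy; apply: hr; lia.
rewrite -avoidance_reflect /reflect_state /=.
have -> : - x = k.+1%:Z by lia.
apply: hm'; split=> [y|y hy] /=.
  by case: (sr (- y)) => ->; [right|left].
by rewrite hl ?opprK //; lia.
Qed.

(** * Averaging over words of signs *)

Fixpoint sign_words (n : nat) : seq (seq int) :=
  if n is m.+1 then
    map (cons 1) (sign_words m) ++ map (cons (-1)) (sign_words m)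
  else [:: [::]].

Definition word_weight (R : realType) (p : R) (b : seq int) : R :=
  \prod_(c <- b) turn_prob p c.

Lemma mem_sign_words (b : seq int) : (forall c, c \in b -> is_sign c) ->
  b \in sign_words (size b).
Proof.
elim: b => [|c b IH] // hb; rewrite [sign_words _]/= mem_cat.
have bw : b \in sign_words (size b).
  by apply: IH => a ab; apply: hb; rewrite in_cons ab orbT.
by case: (hb c (mem_head _ _)) => ->; apply/orP; [left|right];
  apply/mapP; exists b.
Qed.

Lemma size_sign_words n b : b \in sign_words n -> size b = n.
Proof.
elim: n b => [|n IH] b /=; first by rewrite inE => /eqP ->.
by rewrite mem_cat => /orP[] /mapP[b' /IH <- ->].
Qed.

Lemma sign_words_sign n b i :
  b \in sign_words n -> (i < n)%N -> is_sign (nth 0 b i).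
Proof.
elim: n b i => [|n IH] // b i.
by rewrite mem_cat => /orP[] /mapP[b' hb ->]; case: i => [|i] /= hi;
  [left|exact: IH|right|exact: IH].
Qed.

Lemma word_weight_ge0 (R : realType) (p : R) b :
  0 < p < 1 -> 0 <= word_weight p b.
Proof.
by move=> hp; apply: prodr_ge0 => c _; rewrite /turn_prob; case: ifP => _; lra.
Qed.

Lemma sum_sign_wordsS (R : realType) (p : R) n (g : seq int -> R) :
  \sum_(b <- sign_words n.+1) word_weight p b * g b =
  p * \sum_(b <- sign_words n) word_weight p b * g (1 :: b) +
  (1 - p) * \sum_(b <- sign_words n) word_weight p b * g (-1 :: b).
Proof.
rewrite /= big_cat !big_map !mulr_sumr /=.
by congr (_ + _); apply: eq_bigr => b _;
  rewrite /word_weight big_cons mulrA /turn_prob /=.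
Qed.

Definition run (s : state) (b : seq int) : state :=
  foldl (fun s c => rotor_step c s) s b.

Fixpoint avoids (s : state) (b : seq int) : bool :=
  (s.1 != 0) && (if b is c :: b' then avoids (rotor_step c s) b' else true).

Lemma avoidsP s b :
  reflect (forall i, (i <= size b)%N -> (run s (take i b)).1 != 0) (avoids s b).
Proof.
apply: (iffP idP).
  elim: b s => [|c b IH] s /= /andP[s0 hb] [|i] //= hi.
  exact: (IH _ hb).
elim: b s => [|c b IH] s h; rewrite /= (h 0%N) //=.
by apply: IH => i hi; exact: (h i.+1).
Qed.

Lemma avoidance_sum (R : realType) (p : R) n s :
  avoidance p n s = \sum_(b <- sign_words n) word_weight p b * (avoids s b)%:R.
Proof.
elim: n s => [|n IH] s.
  rewrite [sign_words 0]/= big_seq1 /word_weight big_nil mul1r /=.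
  by case: eqP.
rewrite sum_sign_wordsS /=; case: ifP => _ /=; last by rewrite !IH.
by rewrite !(big1 _ _ _ (fun _ _ => mulr0 _)) !mulr0 addr0.
Qed.

(** Conditionally on the first [k] signs, the walk has to avoid [0] from a state
    with last exits at distance at most [j + k] from the origin. *)
Lemma late_avoidance_le (R : realType) (p e : R) (k n j : nat) s :
  0 < p < 1 -> last_exits s -> (`|s.1| <= j)%N ->
  (forall s', last_exits s' -> (`|s'.1| <= j + k)%N -> avoidance p n s' <= e) ->
  \sum_(b <- sign_words (k + n))
    word_weight p b * (avoids (run s (take k b)) (drop k b))%:R <= e.
Proof.
move=> hp; elim: k j s => [|k IH] j s ls sj hn.
  under eq_bigr do rewrite take0 drop0.
  by rewrite -avoidance_sum hn // addn0.
rewrite addSn sum_sign_wordsS /=.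
have step c : is_sign c -> \sum_(b <- sign_words (k + n)) word_weight p b *
    (avoids (run (rotor_step c s) (take k b)) (drop k b))%:R <= e.
  move=> sc; apply: (IH j.+1); first exact: last_exits_step.
    case: ls => /(_ s.1) hs _ _; rewrite /= eqxx.
    by case: (is_signM sc hs) => ->; lia.
  by move=> s' ls' hs'; apply: hn => //; rewrite addnS -addSn.
have h1 := step 1 (or_introl erefl); have h2 := step (-1) (or_intror erefl).
have p0 : 0 <= p by lra.
have p1 : 0 <= 1 - p by lra.
apply: (le_trans (lerD (ler_wpM2l p0 h1) (ler_wpM2l p1 h2))).
by rewrite -mulrDl addrC subrK mul1r.
Qed.

Lemma rotor_chain_eq b b' rho n : (forall i, (i < n)%N -> b i = b' i) ->
  rotor_chain b rho n = rotor_chain b' rho n.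
Proof.
elim: n => [|n IH] //= h; rewrite h // IH // => i hi; apply: h; exact: ltnW.
Qed.

Lemma run_take rho b i : (i <= size b)%N ->
  run (0, rho) (take i b) = rotor_chain (nth 0 b) rho i.
Proof.
elim: i => [|i IH] hi; first by rewrite take0.
by rewrite (take_nth 0) // /run foldl_rcons -/(run _ _) IH // ltnW.
Qed.

Lemma avoids_walk rho k b : (k <= size b)%N ->
  avoids (run (0, rho) (take k b)) (drop k b) <->
  forall i, (k <= i <= size b)%N -> rotor_walk (nth 0 b) rho i <> 0.
Proof.
move=> kb; split=> [/avoidsP h i /andP[ki ib]|h].
  have := h (i - k)%N; rewrite size_drop leq_sub2r // => /(_ isT) /eqP.
  by rewrite /run -foldl_cat -takeD subnKC // -/(run _ _) run_take.
apply/avoidsP => i; rewrite size_drop => hi; apply/eqP.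
rewrite /run -foldl_cat -takeD -/(run _ _) run_take; last first.
  by rewrite -leq_subRL.
by apply: h; rewrite leq_addr /= -leq_subRL.
Qed.

(** * Measurability *)

(** Measurability of an integer-valued function, stated by its fibres so that it
    makes sense for the sigma-algebra generated by [rho0] as well as for that of
    the whole space. *)
Definition measurable_fibers d (T : measurableType d) (f : T -> int) : Prop :=
  forall z, measurable [set w | f w = z].

(** A function chosen among countably many by a measurable index; the rotor at
    the random position of the walker is of this form. *)
Lemma measurable_fibers_at d (T : measurableType d) (f : T -> int)
    (G : int -> T -> int) : measurable_fibers f ->
  (forall a, measurable_fibers (G a)) -> measurable_fibers (fun w => G (f w) w).
Proof.
move=> mf mG z.
rewrite (_ : mkset _ = \bigcup_a ([set w | f w = a] `&` [set w | G a w = z])).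
  apply: countable_bigcupT_measurable => // a.
  by apply: measurableI; [exact: mf|exact: mG].
apply/seteqP; split=> [w /= h|w [a _ [/= <-]]] //.
by exists (f w).
Qed.

Lemma measurable_fibers_cst d (T : measurableType d) (c : int) :
  measurable_fibers (fun _ : T => c).
Proof.
move=> z; have [<-|cz] := pselect (c = z).
  by rewrite (_ : mkset _ = setT) //; apply/seteqP; split.
by rewrite (_ : mkset _ = set0) //; apply/seteqP; split.
Qed.

Lemma measurable_fibers_comp d (T : measurableType d) (f : T -> int)
    (h : int -> int) : measurable_fibers f -> measurable_fibers (h \o f).
Proof.
move=> mf; apply: (@measurable_fibers_at _ _ f (fun a _ => h a)) => // a.
exact: measurable_fibers_cst.
Qed.

Lemma measurable_fibers_comp2 d (T : measurableType d) (f g : T -> int)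
    (h : int -> int -> int) : measurable_fibers f -> measurable_fibers g ->
  measurable_fibers (fun w => h (f w) (g w)).
Proof.
move=> mf mg; apply: (@measurable_fibers_at _ _ f (fun a w => h a (g w))) => // a.
exact: measurable_fibers_comp.
Qed.

Lemma measurable_rotor_chain d (T : measurableType d) (b : nat -> T -> int)
    (rho : int -> T -> int) :
  (forall n, measurable_fibers (b n)) ->
  (forall x, measurable_fibers (rho x)) ->
  forall n,
    measurable_fibers (fun w => (rotor_chain (b^~ w) (rho^~ w) n).1) /\
    forall x, measurable_fibers (fun w => (rotor_chain (b^~ w) (rho^~ w) n).2 x).
Proof.
move=> mb mrho; elim=> [|n [IHx IHr]].
  by split=> //=; exact: measurable_fibers_cst.
set X := fun w => _ in IHx.
have mv : measurable_fibers
    (fun w => b n w * (rotor_chain (b^~ w) (rho^~ w) n).2 (X w)).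
  apply: measurable_fibers_comp2 => //.
  exact: (@measurable_fibers_at _ _ X
    (fun x w => (rotor_chain (b^~ w) (rho^~ w) n).2 x)).
split=> [|x].
  move=> z; rewrite /= [X in measurable X](_ : _ =
    [set w | X w + b n w * (rotor_chain (b^~ w) (rho^~ w) n).2 (X w) = z]).
    exact: (measurable_fibers_comp2 +%R IHx mv).
  by apply/seteqP; split => w; rewrite /= eqxx.
apply: (@measurable_fibers_at _ _ X
  (fun a w => if x == a then b n w * (rotor_chain (b^~ w) (rho^~ w) n).2 a
              else (rotor_chain (b^~ w) (rho^~ w) n).2 x)) => // a.
case: (x == a) => //; exact: (measurable_fibers_comp2 *%R).
Qed.

Lemma measurable_walk_neq0 d (T : measurableType d) (b : nat -> T -> int)
    (rho : int -> T -> int) (D : set nat) :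
  (forall n, measurable_fibers (b n)) ->
  (forall x, measurable_fibers (rho x)) ->
  measurable [set w | forall i, D i -> rotor_walk (b^~ w) (rho^~ w) i <> 0].
Proof.
move=> mb mrho.
rewrite [X in measurable X](_ : _ = \bigcap_(i in D)
   ~` [set w | rotor_walk (b^~ w) (rho^~ w) i = 0]) //.
apply: bigcap_measurableType => i _; apply: measurableC.
exact: (measurable_rotor_chain mb mrho i).1.
Qed.

Lemma measure_bigsetU_le d (T : measurableType d) (R : realType)
    (mu : {measure set T -> \bar R}) (I : Type) (s : seq I) (F : I -> set T) :
  (forall i, measurable (F i)) ->
  (mu (\big[setU/set0]_(i <- s) F i) <= \sum_(i <- s) mu (F i))%E.
Proof.
move=> mF; elim: s => [|i s IH]; first by rewrite !big_nil measure0.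
rewrite !big_cons; apply: le_trans (leeD2l _ IH).
by apply: measureU2 => //; exact: bigsetU_measurable.
Qed.

(** * From words to the probability space *)

(** The sum is the expectation of the function that is bounded by [e]. *)
Lemma weighted_prob_sum_le d (T : measurableType d) (R : realType)
    (P : probability T R) (I : Type) (s : seq I) (x : I -> R) (F : I -> set T)
    (e : R) :
  (forall i, 0 <= x i) -> (forall i, measurable (F i)) ->
  (forall w, \sum_(i <- s) x i * \1_(F i) w <= e) ->
  (\sum_(i <- s) (x i)%:E * P (F i) <= e%:E)%E.
Proof.
move=> x0 mF h.
have m1 i := (measurable_EFinP setT (\1_(F i) : T -> R)).2
  (measurable_indic (mF i)).
have mi i := measurable_funeM (x i)%:E (m1 i).
have i0 i w : (0 <= (\1_(F i) w)%:E :> \bar R)%E by rewrite lee_fin.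
have mi0 i w : (0 <= (x i)%:E * (\1_(F i) w)%:E)%E.
  by rewrite mule_ge0 // lee_fin.
have -> : (\sum_(i <- s) (x i)%:E * P (F i))%E =
    (\int[P]_w (\sum_(i <- s) (x i)%:E * (\1_(F i) w)%:E))%E.
  rewrite ge0_integral_sum //; apply: eq_bigr => i _.
  have <- : (\int[P]_w (\1_(F i) w)%:E = P (F i))%E.
    by rewrite integral_indic // setIT.
  by rewrite -ge0_integralZl_EFin //; exact: (m1 i).
apply: (@le_trans _ _ (\int[P]_w (cst e%:E w))%E).
  apply: ge0_le_integral => //.
  - by move=> w _; apply: sume_ge0.
  - by apply: emeasurable_sum => i; exact: mi.
  - move=> w _; rewrite /=.
    move: (h w); rewrite -lee_fin; apply: le_trans.
    by rewrite -sumEFin; apply: lee_sum => i _; rewrite EFinM.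
rewrite integral_cst // [X in (_ * X)%E](_ : _ = 1%E) ?mule1 //.
exact: probability_setT.
Qed.

Lemma measurable_fibers_RV d (T : measurableType d) (R : realType)
    (P : probability T R) (Y : {RV P >-> int}) : measurable_fibers Y.
Proof.
by move=> z; apply: (@measurable_funPTI _ _ _ _ Y [set z]).
Qed.

(** The event is the union of the events [C b `&` A b]: the word [b] is read on
    [B], and [rho0] is such that the walk driven by [b] avoids [0] between the
    times [k] and [k + n]. The first depends on [B] and the second on [rho0], so
    that their probabilities multiply. *)
Lemma late_avoidance_event_le d (T : measurableType d) (R : realType)
    (P : probability T R) (p alpha beta : R) (B : nat -> {RV P >-> int})
    (rho0 : int -> {RV P >-> int}) (k : nat) (e : R) :
  0 < p < 1 -> iid_signs p B -> random_initial_configuration alpha beta rho0 ->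
  independent_processes B rho0 -> 0 < e ->
  exists n, (P [set w | forall i, (k <= i <= k + n)%N ->
    rotor_walk (fun m => B m w) (fun x => rho0 x w) i <> 0%R] <= e%:E)%E.
Proof.
move=> hp [Bsign Bpos Bneg Bind] [rsign _ _ _ _ _ _ _] indep e0.
have [n hn] := last_exits_avoidance_small k hp e0; exists n.
have mB m : measurable_fibers (B m) by exact: measurable_fibers_RV.
have mrho x : measurable_fibers (rho0 x) by exact: measurable_fibers_RV.
pose N := (k + n)%N.
pose C (b : seq int) :=
  \bigcap_(i in [set` iota 0 N]) (B i @^-1` [set nth 0 b i]).
pose A (b : seq int) := [set w | forall i, (k <= i <= N)%N ->
  rotor_walk (nth 0 b) (fun x => rho0 x w) i <> 0].
have mC b : process_sigma_algebra B (C b).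
  apply: (@bigcap_measurableType _ (g_sigma_algebraType _)) => i _.
  by apply: sub_gen_smallest; exists i, [set nth 0 b i].
have mA b : process_sigma_algebra rho0 (A b).
  apply: (@measurable_walk_neq0 _ (g_sigma_algebraType _)
    (fun i _ => nth 0 b i) (fun x w => rho0 x w)) => [i|x].
    exact: measurable_fibers_cst.
  by move=> z; apply: sub_gen_smallest; exists x, [set z].
have mC' b : measurable (C b).
  apply: bigcap_measurableType => i _; exact: mB.
have mA' b : measurable (A b).
  apply: (@measurable_walk_neq0 _ _ (fun i _ => nth 0 b i)
    (fun x w => rho0 x w)) => // i.
  exact: measurable_fibers_cst.
have PC b : b \in sign_words N -> P (C b) = (word_weight p b)%:E.
  move=> hb; rewrite Bind ?iota_uniq //.
  have -> : word_weight p b = \prod_(i <- iota 0 N) turn_prob p (nth 0 b i).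
    by rewrite /word_weight (big_nth 0) /index_iota subn0 (size_sign_words hb).
  rewrite (big_morph EFin (@EFinM R) erefl) big_seq [RHS]big_seq.
  apply: eq_bigr => i; rewrite mem_iota add0n => iN.
  by case: (sign_words_sign hb iN) => ->; [exact: Bpos|exact: Bneg].
apply: (@le_trans _ _ (P (\big[setU/set0]_(b <- sign_words N) (C b `&` A b)))).
  apply: le_measure; rewrite ?inE.
  - exact: measurable_walk_neq0.
  - by apply: bigsetU_measurable => b _; exact: measurableI.
  move=> w /= hw; rewrite -bigcup_seq; set b := mkseq (B^~ w) N.
  have sb : size b = N by rewrite size_mkseq.
  have nb i : (i < N)%N -> nth 0 b i = B i w by move=> iN; rewrite nth_mkseq.
  exists b; first by rewrite /= -sb; apply: mem_sign_words => c /mapP[i _ ->].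
  split=> [i|i /andP[ki iN]].
    by rewrite /= mem_iota add0n => /nb ->.
  rewrite /rotor_walk (@rotor_chain_eq _ (B^~ w)) => [|j ji].
    by apply: hw; rewrite ki.
  by apply: nb; exact: leq_trans iN.
apply: (le_trans (measure_bigsetU_le _ _ _)) => [b|]; first exact: measurableI.
rewrite [leLHS](_ : _ =
  (\sum_(b <- sign_words N) (word_weight p b)%:E * P (A b))%E).
  apply: weighted_prob_sum_le => // [b|w]; first exact: word_weight_ge0.
  have ls : last_exits (0, fun x => rho0 x w).
    by split=> [x|y|y] /=; [exact: rsign|lia|lia].
  apply: le_trans
    (late_avoidance_le (p := p) (k := k) (n := n) (j := 0) hp ls _ _) => //.
  rewrite big_seq [leRHS]big_seq; apply: ler_sum => b hb.
  apply: ler_wpM2l; first exact: word_weight_ge0.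
  rewrite indicE; case: (boolP (w \in A b)) => //; rewrite inE /A /= => hA.
  have sb := size_sign_words hb.
  suff -> : avoids (run (0, rho0^~ w) (take k b)) (drop k b) by [].
  by apply/avoids_walk; rewrite sb ?leq_addr.
rewrite big_seq [RHS]big_seq; apply: eq_bigr => b hb.
by rewrite -(PC _ hb); exact: (indep _ _ (mC b) (mA b)).
Qed.

Lemma finite_subset_nat_bounded (D : set nat) : ~ infinite_set D ->
  exists k, forall i, (k <= i)%N -> ~ D i.
Proof.
move=> /contrapT /finite_seqP [F ->].
exists (\max_(i <- F) i).+1 => i ki /= iF.
have : (i <= \max_(j <- F) j)%N by exact: (leq_bigmax_seq (F := id) _ iF).
by rewrite leqNgt ki.
Qed.

Theorem corollary1p4 (R : realType) (d : measure_display)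
    (T : measurableType d) (P : probability T R) (p alpha beta : R)
    (B : nat -> {RV P >-> int}) (rho0 : int -> {RV P >-> int})
    (hp : 0 < p < 1) (halpha : 0 <= alpha <= 1) (hbeta : 0 <= beta <= 1)
    (hB : iid_signs p B)
    (hrho0 : random_initial_configuration alpha beta rho0)
    (hBrho0 : independent_processes B rho0) :
  P [set w | infinite_set
       [set n : nat | rotor_walk (fun m => B m w) (fun x => rho0 x w) n = 0]]
  = 1%:E.
Proof.
pose L k := [set w | forall i, (k <= i)%N ->
  rotor_walk (fun m => B m w) (fun x => rho0 x w) i <> 0].
have mwalk (D : set nat) : measurable [set w | forall i, D i ->
    rotor_walk (fun m => B m w) (fun x => rho0 x w) i <> 0].
  apply: (@measurable_walk_neq0 _ _ (fun m w => B m w) (fun x w => rho0 x w)).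
    by move=> m; exact: measurable_fibers_RV.
  by move=> x; exact: measurable_fibers_RV.
have mL k : measurable (L k) by exact: mwalk.
have L0 k : P (L k) = 0%E.
  apply/eqP; rewrite eq_le measure_ge0 andbT; apply/lee_addgt0Pr => e e0.
  rewrite add0e; have [n hn] := late_avoidance_event_le k hp hB hrho0 hBrho0 e0.
  apply: le_trans hn; apply: le_measure; rewrite ?inE //.
  by move=> w /= hw i /andP[ki _]; exact: hw.
have UL0 : P (\bigcup_k L k) = 0%E.
  apply/negligibleP; first exact: bigcupT_measurable.
  by apply: negligible_bigcup => k; apply/(negligibleP _ (mL k)); exact: L0.
rewrite (_ : mkset _ = ~` (\bigcup_k L k)).
  rewrite probability_setC ?UL0 ?sube0 //; exact: bigcupT_measurable.
apply/seteqP; split=> [w /= winf [k _ Lk]|w /= nL].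
  apply: winf; apply: (@sub_finite_set _ _ `I_k); last exact: finite_II.
  by move=> i /= wi; rewrite ltnNge; apply/negP => /Lk.
apply: contrapT => /finite_subset_nat_bounded [k hk].
by apply: nL; exists k.
Qed.
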